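(* Let $\langle T,\bar\mu\rangle$ be a probability tree such that for every $t\in T\smallsetminus\max T$ there is $0<\alpha_t\le\omega$ with $\mathrm{succ}_T(t)=\{t^\frown\langle k\rangle : k<\alpha_t\}$. Then the map $\lambda^{\bar\mu}\colon\mathcal B([T])\to[0,1]$ defined by $\lambda^{\bar\mu}(A)=\mathrm{Lb}(I^*(A))$ is a probability measure on $\mathcal B([T])$ such that $\lambda^{\bar\mu}([t]_T)=\Xi^{\bar\mu}(\{t\})$ for all $t\in T$.
   Context: $\mathrm{Lb}$ is Lebesgue measure. A tree (of sequences) is a non-empty set $T$ of finite sequences with entries in some set, closed under initial segments and ordered by $s\subseteq t$ ($t$ extends $s$). $\mathrm{succ}_T(t)$ is the set of $t'\in T$ extending $t$ with $|t'|=|t|+1$; $\max T=\{t\in T:\mathrm{succ}_T(t)=\emptyset\}$; $\lim T$ is the set of infinite sequences $x$ (indexed by $\omega$) with $x\upharpoonright n\in T$ for all $n<\omega$; $[T]=\lim T\cup\max T$, with the topology generated by $[t]_T=\{x\in[T]:t\subseteq x\}$, $t\in T$. For finite $x$ put $x\upharpoonright n=x$ when $n\ge|x|$. A probability tree is a pair $\langle T,\bar\mu\rangle$ where $T$ is a countable tree of sequences and $\bar\mu=\langle\mu_t:t\in T\smallsetminus\max T\rangle$ with each $\mu_t$ a probability measure on $\mathcal P(\mathrm{succ}_T(t))$. $\Xi^{\bar\mu}$ is the measure on $\mathcal P(T)$ determined by $\Xi^{\bar\mu}(\{t\})=\prod_{k<|t|}\mu_{t\upharpoonright k}(\{t\upharpoonright(k+1)\})$.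 Closed intervals $I_t=[a_t,b_t]\subseteq[0,1]$, $t\in T$, are defined by recursion on $|t|$: $I_{\langle\,\rangle}=[0,1]$; if $t\notin\max T$ then $a_{t^\frown\langle0\rangle}=a_t$, $b_{t^\frown\langle k\rangle}=a_{t^\frown\langle k\rangle}+\mathrm{Lb}(I_t)\,\mu_t(\{t^\frown\langle k\rangle\})$ for $k<\alpha_t$, and $a_{t^\frown\langle k+1\rangle}=b_{t^\frown\langle k\rangle}$ when $k+1<\alpha_t$. For $x\in[T]$, $I^*_x=\bigcap_{n<\omega}I_{x\upharpoonright n}$, and for $A\subseteq[T]$, $I^*(A)=\bigcup_{x\in A}I^*_x$; for $A\in\mathcal B([T])$ the set $I^*(A)$ is Borel in $[0,1]$, so $\lambda^{\bar\mu}$ is well defined. *)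

(* Defs.v *)
From HB Require Import structures.
From mathcomp Require Import all_boot all_order all_algebra.
From mathcomp Require Import all_classical all_reals all_analysis.

Set Implicit Arguments.
Unset Strict Implicit.
Unset Printing Implicit Defensive.

Import Order.TTheory GRing.Theory Num.Theory.

Local Open Scope classical_set_scope.
Local Open Scope ring_scope.

Record tree (X : choiceType) := Tree {
  nodes :> set (seq X);
  nodes_nonempty : nodes !=set0;
  nodes_prefix : forall s t, prefix s t -> nodes t -> nodes s
}.

Section Trees.
Context {X : choiceType} (T : tree X).

Definition succT (t : seq X) : set (seq X) :=
  [set t' | [/\ nodes T t', prefix t t' & size t' = (size t).+1]].

Definition maxT : set (seq X) := [set t | nodes T t /\ succT t = set0].

Definition limT : set (nat -> X) := [set x | forall n, nodes T (mkseq x n)].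

(* Finite (inl) and infinite (inr) sequences live in one sum type. *)
Definition bodyT : set (seq X + (nat -> X)) := inl @` maxT `|` inr @` limT.

(* take n s is s when size s <= n. *)
Definition restr (x : seq X + (nat -> X)) (n : nat) : seq X :=
  match x with inl s => take n s | inr f => mkseq f n end.

Lemma nodes_nil : nodes T [::].
Proof.
by have [t] := nodes_nonempty T; apply: nodes_prefix; exact: prefix0s.
Qed.

Lemma bodyT_nonempty : bodyT !=set0.
Proof.
have [[t mt]|nomax] := pselect (exists t, maxT t).
  by exists (inl t); left; exists t.
have step (t : seq X) : exists t', nodes T t -> succT t t'.
  have [Tt|nTt] := pselect (nodes T t); last by exists [::].
  have [t' st] : succT t !=set0.
    by apply/set0P/eqP => h; apply: nomax; exists t.
  by exists t'.
have [g gP] := choice step.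
pose f n := iter n g [::].
have fT n : nodes T (f n).
  by elim: n => [|n IH] /=; [exact: nodes_nil|have [] := gP _ IH].
have fsucc n : prefix (f n) (f n.+1) /\ size (f n.+1) = (size (f n)).+1.
  by have [] := gP _ (fT n).
have fsize n : size (f n) = n.
  by elim: n => // n IH; rewrite (fsucc n).2 IH.
have [x0 _] : exists x0 : X, True.
  by case: (f 1%N) (fsize 1%N) => // x s _; exists x.
exists (inr (fun n => nth x0 (f n.+1) n)); right; eexists; last by [].
move=> n /=; suff -> : mkseq (fun n => nth x0 (f n.+1) n) n = f n by [].
elim: n => [|n IH]; first by [].
rewrite mkseqS IH; have [/prefixP[r fr] sz] := fsucc n.
move: sz; rewrite fr size_cat fsize -addn1 => /addnI.
by case: r fr => [|y [|]] //= fr _; rewrite nth_cat fsize ltnn subnn /= cats1.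
Qed.

Definition node : Type := set_type (nodes T).

HB.instance Definition _ := Choice.on node.
HB.instance Definition _ := isPointed.Build node (SigSub (mem_set nodes_nil)).
HB.instance Definition _ := @isMeasurable.Build default_measure_display
  node discrete_measurable discrete_measurable0
  discrete_measurableC discrete_measurableU.

Definition branch : Type := set_type bodyT.

HB.instance Definition _ := Choice.on branch.
HB.instance Definition _ :=
  isPointed.Build branch (SigSub (mem_set (projT2 (cid bodyT_nonempty)))).

Definition restrict (x : branch) (n : nat) : seq X := restr (\val x) n.

(* restrict x (size t) = t says exactly that x extends t. *)
Definition cyl (t : node) : set branch :=
  [set x | restrict x (size (\val t)) = \val t].

Lemma take_restrict x m n :
  (m <= n)%N -> take m (restrict x n) = restrict x m.
Proof.
rewrite /restrict; case: (\val x) => [s|f] mn /=; first by rewrite take_takel.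
by rewrite /mkseq -map_take take_iota (minn_idPl mn).
Qed.

Let cyl_cover : \bigcup_(t in [set: node]) cyl t = setT.
Proof.
apply/seteqP; split => // x _.
exists (SigSub (mem_set nodes_nil)) => //=.
by rewrite /cyl /restrict /=; case: (sval x) => [[]|].
Qed.

Let cyl_join (s t : node) (x : branch) : [set: node] s -> [set: node] t ->
  cyl s x -> cyl t x ->
  exists u, [/\ [set: node] u, cyl u x & cyl u `<=` cyl s `&` cyl t].
Proof.
wlog st : s t / (size (\val s) <= size (\val t))%N.
  move=> H _ _ sx tx; have [/H|/ltnW/H] := leqP (size (\val s)) (size (\val t)).
    exact.
  by case/(_ I I tx sx) => u [_ ux us]; exists u; split=> //; rewrite setIC.
move=> _ _ sx tx; exists t; split=> // y ty; split=> //.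
rewrite /cyl /= -(take_restrict y st) (ty : restrict _ _ = _).
by rewrite -[X in take _ X](tx : restrict _ _ = _) take_restrict.
Qed.

HB.instance Definition _ :=
  isBaseTopological.Build branch cyl_cover cyl_join.

Lemma open_branchP (U : set branch) :
  open U <-> exists S : set node, U = \bigcup_(t in S) cyl t.
Proof.
split=> [[S _ <-]|[S ->]]; first by exists S.
by exists S.
Qed.

(* The type [T] equipped with its Borel sigma-algebra. *)
Definition borel_branch : Type := g_sigma_algebraType (@open branch).

HB.instance Definition _ := Measurable.on borel_branch.

Definition inner_set : set (seq X) := nodes T `\` maxT.
Definition inner : Type := set_type inner_set.

Lemma succT_nonempty (t : inner) : succT (\val t) !=set0.
Proof.
have [Tt ntm] := set_mem (valP t).
by apply/set0P/eqP => t0; apply: ntm.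
Qed.

(* The set of immediate successors of t, with its power set as
   sigma-algebra. *)
Definition child (t : inner) : Type := set_type (succT (\val t)).

HB.instance Definition _ (t : inner) := Choice.on (child t).
HB.instance Definition _ (t : inner) :=
  isPointed.Build (child t) (SigSub (mem_set (projT2 (cid (succT_nonempty t))))).
HB.instance Definition _ (t : inner) :=
  @isMeasurable.Build default_measure_display
    (child t) discrete_measurable discrete_measurable0
    discrete_measurableC discrete_measurableU.

End Trees.

Arguments node {X} T.
Arguments branch {X} T.
Arguments borel_branch {X} T.
Arguments inner {X} T.

Record prob_tree (X : choiceType) (R : realType) := ProbTree {
  ptree :> tree X;
  ptree_countable : countable (nodes ptree);
  ptree_measure : forall t : inner ptree, probability (child t) R
}.

Section ProbTrees.
Context {X : choiceType} {R : realType} (P : prob_tree X R).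

(* mu_t({s}); it is 0 unless t is a non-maximal node and s a successor of t. *)
Definition edge (t s : seq X) : R :=
  if insub t is Some u then
    fine (ptree_measure (u : inner P) [set c | \val c = s])
  else 0.

Definition node_weight (t : node P) : R :=
  \prod_(k < size (\val t)) edge (take k (\val t)) (take k.+1 (\val t)).

Lemma edge_ge0 t s : 0 <= edge t s.
Proof. by rewrite /edge; case: insub => // u; exact: fine_ge0. Qed.

Lemma node_weight_ge0 t : 0 <= node_weight t.
Proof. by apply: prodr_ge0 => k _; exact: edge_ge0. Qed.

Definition Xi (A : set (node P)) : \bar R := \esum_(t in A) (node_weight t)%:E.

Let Xi0 : Xi set0 = 0%E.
Proof. exact: esum_set0. Qed.

Let Xi_ge0 A : (0 <= Xi A)%E.
Proof. by apply: esum_ge0 => t _; rewrite lee_fin node_weight_ge0. Qed.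

Let Xi_semi_sigma_additive : semi_sigma_additive Xi.
Proof.
move=> F _ tF _; rewrite /Xi nneseries_sum_bigcup//; last first.
  by move=> t; rewrite lee_fin node_weight_ge0.
by apply: is_cvg_ereal_nneg_natsum => n _; exact: Xi_ge0.
Qed.

HB.instance Definition _ :=
  isMeasure.Build _ _ _ Xi Xi0 Xi_ge0 Xi_semi_sigma_additive.

Lemma Xi_set1 t : Xi [set t] = (node_weight t)%:E.
Proof. by rewrite /Xi esum_set1// lee_fin node_weight_ge0. Qed.

End ProbTrees.

Section Intervals.
Context {R : realType} (P : prob_tree nat R).

Definition Lb_itv (ab : R * R) : R := fine (lebesgue_measure `[ab.1, ab.2]%classic).

(* The left endpoint of the k-th child, where p j is the mass of the j-th. *)
Fixpoint child_left (a l : R) (p : nat -> R) (k : nat) : R :=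
  if k is j.+1 then child_left a l p j + l * p j else a.

(* The argument is the reversed node: its head is the last entry. *)
Fixpoint endpoints_rev (r : seq nat) : R * R :=
  if r is k :: r' then
    let ab := endpoints_rev r' in
    let p j := edge P (rev r') (rcons (rev r') j) in
    let a := child_left ab.1 (Lb_itv ab) p k in
    (a, a + Lb_itv ab * p k)
  else (0, 1).

Definition endpoints (t : seq nat) : R * R := endpoints_rev (rev t).

Definition leftI (t : seq nat) : R := (endpoints t).1.
Definition rightI (t : seq nat) : R := (endpoints t).2.

Definition I_ (t : seq nat) : set R := `[leftI t, rightI t]%classic.

Lemma I_nil : I_ [::] = `[0, 1]%classic.
Proof. by []. Qed.

Lemma leftI_0 t : leftI (rcons t 0%N) = leftI t.
Proof. by rewrite /leftI /endpoints rev_rcons. Qed.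

Lemma rightI_rcons t k :
  rightI (rcons t k) = leftI (rcons t k) +
    fine (lebesgue_measure (I_ t)) * edge P t (rcons t k).
Proof. by rewrite /I_ /rightI /leftI /endpoints rev_rcons /= !revK. Qed.

Lemma leftI_S t k : leftI (rcons t k.+1) = rightI (rcons t k).
Proof. by rewrite /rightI /leftI /endpoints !rev_rcons. Qed.

Definition Istar_pt (x : branch P) : set R := \bigcap_n I_ (restrict x n).

Definition Istar (A : set (branch P)) : set R := \bigcup_(x in A) Istar_pt x.

Definition lambda (A : set (branch P)) : \bar R := lebesgue_measure (Istar A).

End Intervals.

(* The set of k < alpha for an ordinal alpha <= omega; None stands for omega. *)
Definition below (alpha : option nat) : set nat :=
  if alpha is Some n then `I_n else setT.

(* Main.v *)
(* Off the countable set of endpoints of the intervals I_t, two distinct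
   intervals of the same level never meet, and (the masses at each inner node
   adding up to 1) every point of [0, 1] lies on exactly one I*_x. This gives a
   map phi from [0, 1] minus the endpoints to [T] such that I*(A) is, up to
   countably many points, the preimage of A, and the preimage of [t]_T is I_t.
   Hence lambda is the image of Lebesgue measure under phi, and lambda([t]_T)
   is the length of I_t. *)
From HB Require Import structures.
Require Import Defs.
From mathcomp Require Import all_boot all_order all_algebra.
From mathcomp Require Import all_classical all_reals all_analysis.

Set Implicit Arguments.
Unset Strict Implicit.
Unset Printing Implicit Defensive.

Import Order.TTheory GRing.Theory Num.Theory.
Import numFieldNormedType.Exports.

Local Open Scope classical_set_scope.
Local Open Scope ring_scope.

(** * Lengths of the intervals *)

Section Weights.
Context {R : realType} (P : prob_tree nat R).

(** [node_weight] on raw sequences, so that induction along [rcons] carries no proof of membership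
    in the tree. *)
Definition weight (t : seq nat) : R :=
  \prod_(k < size t) edge P (take k t) (take k.+1 t).

Lemma weight_rcons t k : weight (rcons t k) = weight t * edge P t (rcons t k).
Proof.
rewrite /weight size_rcons big_ord_recr /= -cats1 take_size_cat//.
rewrite take_oversize ?size_cat ?addn1//; congr (_ * _).
by apply: eq_bigr => i _; rewrite !takel_cat// ltnW.
Qed.

Lemma weight_ge0 t : 0 <= weight t.
Proof. by apply: prodr_ge0 => k _; exact: edge_ge0. Qed.

Definition cumul t k : R := \sum_(0 <= j < k) edge P t (rcons t j).

Lemma cumulS t k : cumul t k.+1 = cumul t k + edge P t (rcons t k).
Proof. by rewrite /cumul big_nat_recr. Qed.

Lemma cumul_le t : {homo cumul t : m n / (m <= n)%N >-> m <= n}.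
Proof.
apply: homo_leq => // [x y z|n]; first exact: le_trans.
by rewrite cumulS lerDl edge_ge0.
Qed.

Lemma rightI_weight t : rightI P t = leftI P t + weight t.
Proof.
elim/last_ind: t => [|t k IH].
  by rewrite /rightI /leftI /weight /endpoints/= big_ord0 add0r.
rewrite rightI_rcons /I_ lebesgue_measure_itv/= IH weight_rcons lte_fin ltrDl.
(* Degenerate intervals are treated apart because the formula for the measure of an interval tests
   whether its endpoints are strictly ordered. *)
have := weight_ge0 t; rewrite le_eqVlt => /predU1P[<-|->]; last first.
  by rewrite -EFinB /= addrAC subrr add0r.
by rewrite ltxx /= !mul0r.
Qed.

Lemma leftI_rcons t k :
  leftI P (rcons t k) = leftI P t + weight t * cumul t k.
Proof.
elim: k => [|k IH]; first by rewrite leftI_0 /cumul big_nil mulr0 addr0.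
by rewrite leftI_S rightI_weight IH weight_rcons cumulS mulrDr addrA.
Qed.

(** Empty when [rcons (\val u) j] is not a child, so that [j] can range over all of [nat]. *)
Definition sibling (u : inner P) (j : nat) : set (child u) :=
  [set c | \val c = rcons (\val u) j].
Arguments sibling : clear implicits.

Lemma trivIset_sibling (u : inner P) : trivIset setT (sibling u).
Proof.
by move=> i j _ _ [c [ci cj]]; move: cj; rewrite /sibling /= ci => /rcons_inj[].
Qed.

Lemma cumul_measure (u : inner P) n :
  (cumul (\val u) n)%:E = (\sum_(0 <= j < n) ptree_measure u (sibling u j))%E.
Proof.
rewrite /cumul -sumEFin; apply: eq_bigr => j _.
by rewrite /edge valK fineK// fin_num_measure.
Qed.

(** At an inner node the sum is the mass of a finite disjoint union of sets of children; elsewhere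
    every [edge] is 0 by default. *)
Lemma cumul_le1 t n : cumul t n <= 1.
Proof.
have [u _ <-|nt] := @insubP _ _ (inner P) t; last first.
  by rewrite /cumul big1 ?ler01// => j _; rewrite /edge insubN.
rewrite -lee_fin cumul_measure big_mkord -measure_bigsetU//.
  exact: probability_le1.
exact: trivIset_sibling.
Qed.

Lemma subset_I_rcons t k : I_ P (rcons t k) `<=` I_ P t.
Proof.
rewrite /I_ => p /=; rewrite !in_itv/= !rightI_weight !leftI_rcons weight_rcons.
rewrite -addrA -mulrDr -cumulS => /andP[lp pr].
have w0 := weight_ge0 t.
have c0 : 0 <= cumul t k by apply: sumr_ge0 => j _; exact: edge_ge0.
apply/andP; split.
  by apply: le_trans lp; rewrite lerDl mulr_ge0.
by apply: (le_trans pr); rewrite lerD2l ler_piMr// cumul_le1.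
Qed.

Lemma subset_I_take t n : I_ P t `<=` I_ P (take n t).
Proof.
elim/last_ind: t => // t k IH.
have [tn|nt] := ltnP (size t) n; first by rewrite take_oversize// size_rcons.
rewrite -cats1 takel_cat// cats1; apply: subset_trans IH.
exact: subset_I_rcons.
Qed.

(** * Endpoints, and separation of intervals of the same level *)

(** All sequences of naturals contribute, not only nodes, so countability is that of [seq nat]. *)
Definition endpts : set R := range (leftI P) `|` range (rightI P).

Lemma countable_endpts : countable endpts.
Proof.
by rewrite /endpts -bigcup2E; apply: bigcup_countable => // -[|[|n]] _ //=;
  rewrite /bigcup2 /=; (try exact: countable0);
  apply: sub_countable (card_image_le _ _) _; exact: countableP.
Qed.

(** For [k < l] the right end of the first interval is at most the left end of the second, so a
    common point would be that left end. *)
Lemma I_rcons_inj t k l p : ~ endpts p ->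
  I_ P (rcons t k) p -> I_ P (rcons t l) p -> k = l.
Proof.
move=> np; wlog kl : k l / (k < l)%N => [H|].
  have [/H//|lk kp lp|//] := ltngtP k l.
  by apply/esym; exact: (H l k).
rewrite /I_ /= !in_itv/= => /andP[_ pr] /andP[lp _]; exfalso; apply: np; left.
exists (rcons t l) => //; apply/le_anti; rewrite lp (le_trans pr)//.
rewrite -leftI_S !leftI_rcons lerD2l ler_wpM2l ?weight_ge0//.
exact: cumul_le.
Qed.

Lemma I_size_inj s t p : ~ endpts p -> size s = size t ->
  I_ P s p -> I_ P t p -> s = t.
Proof.
move=> np; elim/last_ind: s t => [|s k IH] t; first by case: t.
elim/last_ind: t => [|t l _]; first by rewrite size_rcons.
rewrite !size_rcons => -[st] sp tp.
have {}st := IH _ st (subset_I_rcons sp) (subset_I_rcons tp).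
by subst t; rewrite (I_rcons_inj np sp tp).
Qed.

(** * At most one branch through a point off the endpoints *)

Lemma branchP (x : branch P) :
  (exists2 s, maxT P s & \val x = inl s) \/
  (exists2 f, limT P f & \val x = inr f).
Proof. by case: (set_mem (valP x)) => -[s sT <-]; [left|right]; exists s. Qed.

Lemma restrict_nodes (x : branch P) n : nodes P (Defs.restrict x n).
Proof.
rewrite /Defs.restrict; have [[s [Ts _] ->]|[f fT ->]] := branchP x; last exact: fT.
by apply: nodes_prefix Ts; exact: prefix_take.
Qed.

Lemma maxT_prefix s t : maxT P s -> nodes P t -> prefix s t -> t = s.
Proof.
move=> [_ s0] Tt /prefixP[[|k r] tE]; first by rewrite tE cats0.
have : succT P s (rcons s k).
  split; last by rewrite size_rcons.
    by apply: nodes_prefix Tt; rewrite tE -cat_rcons prefix_prefix.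
  exact: prefix_rcons.
by rewrite s0.
Qed.

(** The restriction of [x] to the length of [t] also has [p] in its interval, so [I_size_inj]
    identifies it with [t] when the lengths agree. *)
Lemma Istar_pt_cyl (t : node P) x p : ~ endpts p -> Istar_pt x p ->
  I_ P (\val t) p -> cyl t x.
Proof.
move=> np xp tp; rewrite /cyl /=; set n := size (\val t).
have [ns|] := eqVneq (size (Defs.restrict x n)) n.
  by apply: I_size_inj np ns _ tp; exact: xp.
have := xp n I; rewrite /Defs.restrict.
have [[s sT ->]|[f _ ->]] /= := branchP x; last by rewrite size_mkseq eqxx.
rewrite size_take; case: ltnP => [_|sn]; first by rewrite eqxx.
(* Here [x] is a maximal node [s] no longer than [t]. Separation at the level of [s] makes [s] an
   initial segment of [t], and maximality forces [t = s]. *)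
rewrite take_oversize// => sp _; apply/esym/(maxT_prefix sT).
  exact: set_mem (valP t).
suff -> : s = take (size s) (\val t) by exact: prefix_take.
apply: I_size_inj np _ sp _; first by rewrite size_takel.
exact: subset_I_take tp.
Qed.

(** By [Istar_pt_cyl], every restriction of one branch is a restriction of the other. *)
Lemma Istar_pt_inj (x y : branch P) p : ~ endpts p ->
  Istar_pt x p -> Istar_pt y p -> x = y.
Proof.
move=> np.
have H (x' y' : branch P) n : Istar_pt x' p -> Istar_pt y' p ->
    Defs.restrict y' (size (Defs.restrict x' n)) = Defs.restrict x' n.
  move=> xp yp.
  have := @Istar_pt_cyl (SigSub (mem_set (restrict_nodes x' n))) y' p np yp.
  by apply; exact: xp.
move=> xp yp; apply: val_inj.
have Hx n := H x y n xp yp; have Hy n := H y x n yp xp; move: Hx Hy.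
rewrite /Defs.restrict.
have [[s _ ->]|[f _ ->]] := branchP x;
  have [[s' _ ->]|[f' _ ->]] := branchP y => /=.
- move=> /(_ (size s)) + /(_ (size s')); rewrite !take_size => a b.
  congr inl; have [ss|/ltnW ss] := leqP (size s) (size s').
    by rewrite -[LHS](take_oversize ss).
  by rewrite -[RHS](take_oversize ss).
(* One step past the length of [s], the infinite branch has a longer restriction than [s] can
   supply. *)
- move=> _ /(_ (size s).+1); rewrite take_oversize ?size_mkseq// => /(congr1 size).
  by rewrite size_mkseq => /eqP; rewrite ltn_eqF.
- move=> /(_ (size s').+1); rewrite take_oversize ?size_mkseq// => /(congr1 size).
  by rewrite size_mkseq => /eqP; rewrite ltn_eqF.
- move=> e _; congr inr; apply/funext => n.
  have := congr1 (nth 0%N ^~ n) (e n.+1).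
  by rewrite size_mkseq !nth_mkseq.
Qed.

Lemma cyl_Istar_pt (t : node P) x p :
  cyl t x -> Istar_pt x p -> I_ P (\val t) p.
Proof. by move=> <-; apply. Qed.

End Weights.

Arguments sibling {R P} u j.

(** * A branch through every point off the endpoints *)

Section Succ.
Context {R : realType} (P : prob_tree nat R).
Context (succP : forall t : seq nat, inner_set P t ->
  exists alpha : option nat, alpha <> Some 0%N /\
    succT P t = [set rcons t k | k in below alpha]).

(** By [succP] the sets [sibling u j] exhaust the children, so their masses add up to the total mass
    1. *)
Lemma cumul_cvg1 (u : inner P) : cumul P (\val u) n @[n --> \oo] --> (1 : R).
Proof.
suff : (cumul P (\val u) n)%:E @[n --> \oo] --> (1 : R)%:E by move/fine_cvgP => [].
have <- : ptree_measure u (\bigcup_j sibling u j) = 1%E.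
  rewrite -[RHS](probability_setT (ptree_measure u)); congr (ptree_measure u _).
  apply/seteqP; split => // c _.
  have [alpha [_ uE]] := succP (set_mem (valP u)).
  have : [set rcons (\val u) k | k in below alpha] (\val c).
    by rewrite -uE; exact: set_mem (valP c).
  by case=> k _ kE; exists k => //; rewrite /sibling /= -kE.
under eq_fun do rewrite cumul_measure.
by apply: measure_sigma_additive => //; exact: trivIset_sibling.
Qed.

(** The left ends of the child intervals tend to the right end of [I_ P t], hence eventually exceed
    [p]; the index just before the first such one is the [k] sought. *)
Lemma I_child t p : inner_set P t -> ~ endpts P p -> I_ P t p ->
  exists k, nodes P (rcons t k) /\ I_ P (rcons t k) p.
Proof.
move=> ut np tp.
have wgt0 : leftI P t < p < rightI P t.
  move: tp; rewrite /I_ /= in_itv/= !lt_neqAle => /andP[-> ->]; rewrite !andbT.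
  by apply/andP; split; apply/eqP => e; apply: np; [left|right]; exists t.
have [k pk] : exists k, p < leftI P (rcons t k).
  have : leftI P (rcons t k) @[k --> \oo] --> leftI P t + weight P t * 1.
    under eq_fun do rewrite leftI_rcons.
    apply: cvgD; first exact: cvg_cst.
    apply: cvgM; first exact: cvg_cst.
    exact: (cumul_cvg1 (SigSub (mem_set ut))).
  rewrite mulr1 -rightI_weight => /cvgr_gt /(_ p).
  case/andP: wgt0 => _ /[swap] /[apply] -[k _ /(_ k)/=] pk.
  by exists k; apply: pk.
have [|[|m] mp min] := @ex_minnP (fun k => p < leftI P (rcons t k)).
- by exists k.
- by move: mp wgt0; rewrite leftI_0 => /ltW; rewrite leNgt => /negbTE ->.
have lm : leftI P (rcons t m) <= p.
  by rewrite leNgt; apply/negP => /min; rewrite ltnn.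
exists m; split; last by rewrite /I_ /= in_itv/= lm -leftI_S ltW.
pose u : inner P := SigSub (mem_set ut).
(* If [rcons t m] were not a node, its edge would have mass 0 and its interval would collapse,
   although [p] is at least its left end and below its right end. *)
have [[c cE]|n0] := pselect (sibling u m !=set0).
  by have [] := set_mem (valP c); rewrite (cE : \val c = _).
have e0 : edge P t (rcons t m) = 0.
  rewrite -[t]/(\val u) /edge valK -[X in ptree_measure u X]/(sibling u m).
  suff -> : sibling u m = set0 by rewrite measure0.
  by apply/eqP; apply/negPn/negP => /set0P.
move: mp; rewrite leftI_S rightI_weight weight_rcons e0 mulr0 addr0.
by rewrite ltNge lm.
Qed.

Lemma inner_or_max t : nodes P t -> inner_set P t \/ maxT P t.
Proof. by have [|] := pselect (maxT P t); [right|left]. Qed.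

(** Either the interval of a maximal node contains [p], giving a finite branch, or [I_child] can be
    iterated forever, giving an infinite one. *)
Lemma Istar_pt_exists p : ~ endpts P p -> I_ P [::] p ->
  exists x : branch P, Istar_pt x p.
Proof.
move=> np p01.
have [[t mt tp]|nomax] := pselect (exists2 t, maxT P t & I_ P t p).
  have bt : bodyT P (inl t) by left; exists t.
  by exists (SigSub (mem_set bt)) => n _; exact: subset_I_take.
(* The premises sit under the existential so that [choice] yields a total function, with default
   0. *)
have step t : exists k, nodes P t -> I_ P t p ->
    nodes P (rcons t k) /\ I_ P (rcons t k) p.
  have [[Tt tp]|nt] := pselect (nodes P t /\ I_ P t p); last first.
    by exists 0%N => Tt tp; exfalso; exact: nt.
  have [ut|mt] := inner_or_max Tt; last by exfalso; apply: nomax; exists t.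
  by have [k kP] := I_child ut np tp; exists k.
have [g gP] := choice step.
pose h n := iter n (fun t => rcons t (g t)) [::].
pose f n := g (h n).
have fE n : mkseq f n = h n by elim: n => // n IH; rewrite mkseqS IH.
have hP n : nodes P (h n) /\ I_ P (h n) p.
  elim: n => [|n [Tn pn]]; last exact: gP.
  by split=> //; exact: nodes_nil.
have bf : bodyT P (inr f).
  by right; exists f => // n; rewrite /= fE; exact: (hP n).1.
exists (SigSub (mem_set bf)) => n _; rewrite /Defs.restrict /= fE.
exact: (hP n).2.
Qed.

(** * The map to branches and measurability *)

Let E : set R := `[0, 1]%classic `\` endpts P.

Lemma measurable_endpts : measurable (endpts P : set (measurableTypeR R)).
Proof. exact: countable_measurable (@countable_endpts _ _). Qed.

Lemma measurable_E : measurable (E : set (measurableTypeR R)).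
Proof. by apply: measurableD => //; exact: measurable_endpts. Qed.

Lemma branch_map_exists :
  exists phi : R -> branch P, forall p, E p -> Istar_pt (phi p) p.
Proof.
have H p : exists x : branch P, E p -> Istar_pt x p.
  have [[p01 np]|nE] := pselect (E p); last by exists point.
  by have [x xp] := Istar_pt_exists np p01; exists x.
by have [phi phiP] := choice H; exists phi.
Qed.

Lemma Istar_sub01 (A : set (branch P)) : Istar A `<=` `[0, 1]%classic.
Proof.
by move=> p [x _ xp]; have := @subset_I_take _ _ _ 0%N _ (xp 0%N I); rewrite take0.
Qed.

Section BranchMap.
Context (phi : R -> branch P) (phiP : forall p, E p -> Istar_pt (phi p) p).

(** By uniqueness of the branch, a point of [Istar_pt x] off the endpoints is sent by [phi] to
    [x]. *)
Lemma Istar_endptsC A : Istar A `\` endpts P = E `&` phi @^-1` A.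
Proof.
apply/seteqP; split => p /=.
  move=> [Ap np]; have Ep : E p by split => //; exact: Istar_sub01 Ap.
  split => //; case: Ap => x Ax xp.
  by rewrite (Istar_pt_inj np (phiP Ep) xp).
by move=> [Ep Ap]; split; [exists (phi p) => //; exact: phiP|exact: Ep.2].
Qed.

Lemma preimage_cyl (t : node P) :
  E `&` phi @^-1` (cyl t) = I_ P (\val t) `\` endpts P.
Proof.
apply/seteqP; split => p /=.
  by move=> [Ep tp]; split; [exact: cyl_Istar_pt tp (phiP Ep)|exact: Ep.2].
move=> [tp np]; have Ep : E p.
  by split => //; have := @subset_I_take _ _ _ 0%N _ tp; rewrite take0.
by split => //; apply: Istar_pt_cyl np (phiP Ep) tp.
Qed.

Lemma countable_node (T : tree nat) : countable [set: node T].
Proof. exact: countableP. Qed.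

(** Open sets generate the sigma-algebra and are countable unions of cylinders, whose preimages are
    intervals minus a countable set. *)
Lemma measurable_phi :
  @measurable_fun _ _ (measurableTypeR R) (borel_branch P) E phi.
Proof.
apply: (@measurability _ _ (measurableTypeR R) (borel_branch P) E phi
  (@open (branch P)) erefl) => _ [U /open_branchP[S ->] <-].
(* The union over [S] is padded with empty sets to a union over all nodes, a countable type. *)
rewrite preimage_bigcup setI_bigcupr bigcup_mkcond.
apply: countable_bigcupT_measurable; first exact: countable_node.
move=> t; case: ifP => // _; rewrite preimage_cyl.
by apply: measurableD; [exact: measurable_itv|exact: measurable_endpts].
Qed.

Lemma measurable_Istar_endptsI (A : set (branch P)) :
  measurable (Istar A `&` endpts P : set (measurableTypeR R)).
Proof.
apply: countable_measurable => //.
by apply: sub_countable (@countable_endpts _ P); exact: subset_card_le.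
Qed.

Lemma measurable_Istar_endptsC (A : set (borel_branch P)) : measurable A ->
  measurable (Istar A `\` endpts P : set (measurableTypeR R)).
Proof. by rewrite Istar_endptsC => mA; exact: measurable_phi measurable_E _ mA. Qed.

(** The part inside [endpts P] is countable; the rest is a preimage under [phi]. *)
Lemma measurable_Istar (A : set (borel_branch P)) : measurable A ->
  measurable (Istar A : set (measurableTypeR R)).
Proof.
move=> mA; rewrite -(setUIDK (Istar A) (endpts P)).
by apply: measurableU; [exact: measurable_Istar_endptsI|exact: measurable_Istar_endptsC].
Qed.

Lemma lebesgue_endptsC (B : set (measurableTypeR R)) : measurable B ->
  lebesgue_measure (B `\` endpts P) = lebesgue_measure B.
Proof.
move=> mB.
have h : lebesgue_measure (B `&` endpts P) = 0%E.
  apply: countable_lebesgue_measure0.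
  by apply: sub_countable (@countable_endpts _ P); exact: subset_card_le.
have me := measurable_endpts.
rewrite -[in RHS](setUIDK B (endpts P)) setUC measureU0//.
  exact: measurableD.
exact: measurableI.
Qed.

(** * The image measure and its values on cylinders *)

Lemma lambda_phi (A : set (borel_branch P)) : measurable A ->
  lambda A = lebesgue_measure (E `&` phi @^-1` A).
Proof.
by move=> mA; rewrite -Istar_endptsC lebesgue_endptsC//; exact: measurable_Istar.
Qed.

Lemma measurable_cyl (t : node P) : measurable (cyl t : set (borel_branch P)).
Proof.
by apply: sub_gen_smallest; apply/open_branchP; exists [set t]; rewrite bigcup_set1.
Qed.

Lemma lambda_cyl (t : node P) : lambda (cyl t) = Xi [set t].
Proof.
rewrite lambda_phi; last exact: measurable_cyl.
rewrite preimage_cyl lebesgue_endptsC; last exact: measurable_itv.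
rewrite Xi_set1 /I_ lebesgue_measure_itv /= rightI_weight lte_fin ltrDl.
have := weight_ge0 P (\val t); rewrite le_eqVlt => /predU1P[w0|w0].
  by rewrite -w0 ltxx /node_weight -/(weight P (\val t)) -w0.
by rewrite w0 -EFinB addrAC subrr add0r.
Qed.

Lemma lambda_setT : lambda [set: branch P] = 1%E.
Proof.
pose t0 : node P := SigSub (mem_set (nodes_nil P)).
(* Every branch extends the root, whose weight is an empty product. *)
rewrite (_ : setT = cyl t0).
  by rewrite lambda_cyl Xi_set1 /node_weight /= big_ord0.
by apply/seteqP; split => // x _; rewrite /cyl /= -(take_restrict x (leqnn 0)) take0.
Qed.

Lemma lambda0 : lambda (@set0 (branch P)) = 0%E.
Proof. by rewrite /lambda /Istar bigcup_set0 measure0. Qed.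

(** The sets [Istar (F n)] may still share endpoints of intervals, so additivity is transferred from
    the preimages under [phi], which are truly disjoint. *)
Lemma lambda_sigma_additive :
  semi_sigma_additive (@lambda R P : set (borel_branch P) -> \bar R).
Proof.
move=> F mF tF mUF; rewrite lambda_phi// preimage_bigcup setI_bigcupr.
under eq_fun do under eq_bigr do rewrite lambda_phi//.
apply: measure_semi_sigma_additive.
- by move=> n; exact: measurable_phi measurable_E _ (mF n).
- by move=> i j _ _ [p [[_ pi] [_ pj]]]; apply: tF => //; exists (phi p).
- apply: bigcup_measurable => n _; exact: measurable_phi measurable_E _ (mF n).
Qed.
End BranchMap.
End Succ.

Theorem theorem6p13 (R : realType) (P : prob_tree nat R)
  (succP : forall t : seq nat, inner_set P t ->
     exists alpha : option nat, alpha <> Some 0%N /\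
       succT P t = [set rcons t k | k in below alpha]) :
  (forall A : set (borel_branch P), measurable A ->
     measurable (Istar A : set (measurableTypeR R))) /\
  (exists lam : probability (borel_branch P) R,
     forall A : set (borel_branch P), measurable A -> lam A = lambda A) /\
  (forall t : node P, lambda (cyl t) = Xi [set t]).
Proof.
have [phi phiP] := branch_map_exists succP.
split; first by move=> A; exact: measurable_Istar phiP _.
split; last by move=> t; exact: lambda_cyl phiP t.
(* [lambda] itself is packed as the probability, so the required equality holds by conversion. *)
pose l : set (borel_branch P) -> \bar R := @lambda R P.
pose mi := isMeasure.Build _ (borel_branch P) R l (@lambda0 R P)
  (fun A => measure_ge0 _ _) (lambda_sigma_additive phiP).
pose m : {measure set (borel_branch P) -> \bar R} := HB.pack l mi.
pose pi := Measure_isProbability.Build _ (borel_branch P) R m (lambda_setT phiP).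
pose lam : probability (borel_branch P) R := HB.pack l m pi.
by exists lam.
Qed.
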